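(* For every metric measure space $\mathfrak X$ exactly one of the following holds: (A) the spaces ${\rm BMO}^p(\mathfrak X)$, $p\in[1,\infty)$, all coincide; (B) there is $p_0\in(1,\infty)$ such that for distinct $p_1,p_2\in[1,\infty)$ the spaces ${\rm BMO}^{p_1}(\mathfrak X)$ and ${\rm BMO}^{p_2}(\mathfrak X)$ coincide if and only if $\max\{p_1,p_2\}<p_0$; (C) there is $p_0\in[1,\infty)$ such that for distinct $p_1,p_2\in[1,\infty)$ the spaces ${\rm BMO}^{p_1}(\mathfrak X)$ and ${\rm BMO}^{p_2}(\mathfrak X)$ coincide if and only if $\max\{p_1,p_2\}\le p_0$. Conversely, each of (A), (B) for every $p_0\in(1,\infty)$, and (C) for every $p_0\in[1,\infty)$, is realized by some metric measure space $\mathfrak X$.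
   Context: A metric measure space is $(X,\rho,\mu)$ with $X$ nonempty, $\rho$ a metric, $\mu$ a nonnegative Borel measure. For locally integrable $f$ and an open ball $B$ with $\mu(B)\in(0,\infty)$, $f_B=\mu(B)^{-1}\int_Bf\,d\mu$. For $p\in[1,\infty)$, ${\rm BMO}^p(\mathfrak X)$ consists of locally integrable $f$ with $\|f\|_{*,p}=\sup_B\big(\mu(B)^{-1}\int_B|f-f_B|^pd\mu\big)^{1/p}<\infty$, the supremum over open balls $B$ with $\mu(B)\in(0,\infty)$; functions differing by a constant are identified. ''Coincide'' means equal as sets of functions. *)

(* Defs.v *)
From HB Require Import structures.
From mathcomp Require Import all_boot all_order all_algebra.
From mathcomp Require Import all_classical all_reals all_analysis.
Set Implicit Arguments. Unset Strict Implicit. Unset Printing Implicit Defensive.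
Import Order.TTheory GRing.Theory Num.Theory.
Local Open Scope classical_set_scope.
Local Open Scope ring_scope.

Section MMS.
Variables (R : realType) (T : pointedType).

Definition is_metric (rho : T -> T -> R) : Prop :=
  [/\ forall x y, 0 <= rho x y,
      forall x y, rho x y = 0 <-> x = y,
      forall x y, rho x y = rho y x &
      forall x y z, rho x z <= rho x y + rho y z].

Definition mball (rho : T -> T -> R) (x : T) (r : R) : set T :=
  [set y | rho x y < r].

Definition mopen (rho : T -> T -> R) : set (set T) :=
  [set A | forall x, A x -> exists2 r : R, 0 < r & mball rho x r `<=` A].

Definition borelT (rho : T -> T -> R) := g_sigma_algebraType (mopen rho).

Variables (rho : T -> T -> R) (mu : {measure set (borelT rho) -> \bar R}).

Definition admissible_ball (B : set T) : Prop :=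
  exists x r, 0 < r /\ B = mball rho x r /\ (0 < mu B < +oo)%E.

Definition loc_integrable (f : T -> R) : Prop :=
  forall x r, 0 < r -> (mu (mball rho x r) < +oo)%E ->
    mu.-integrable (mball rho x r : set (borelT rho)) (EFin \o f).

Definition ball_avg (f : T -> R) (B : set T) : R :=
  (fine (mu B))^-1 * fine (\int[mu]_(y in (B : set (borelT rho))) (f y)%:E).

Definition mean_osc (p : R) (f : T -> R) (B : set T) : \bar R :=
  (((fine (mu B))^-1)%:E *
    \int[mu]_(y in (B : set (borelT rho))) ((`|f y - ball_avg f B| `^ p)%:E))
  `^ p^-1.

Definition bmo_norm (p : R) (f : T -> R) : \bar R :=
  ereal_sup [set mean_osc p f B | B in admissible_ball].

(* BMO^p as a set of functions (identification modulo constants does not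
   affect equality of these sets, since both are closed under adding
   constants) *)
Definition BMO (p : R) : set (T -> R) :=
  [set f | loc_integrable f /\ (bmo_norm p f < +oo)%E].

End MMS.

Definition bmo_coincide (R : realType) (T : pointedType) (rho : T -> T -> R)
  (mu : {measure set (borelT rho) -> \bar R}) (p1 p2 : R) : Prop :=
  BMO mu p1 = BMO mu p2.

Definition caseA (R : realType) (T : pointedType) (rho : T -> T -> R)
  (mu : {measure set (borelT rho) -> \bar R}) : Prop :=
  forall p1 p2 : R, 1 <= p1 -> 1 <= p2 -> bmo_coincide mu p1 p2.

Definition caseB (R : realType) (T : pointedType) (rho : T -> T -> R)
  (mu : {measure set (borelT rho) -> \bar R}) (p0 : R) : Prop :=
  1 < p0 /\
  forall p1 p2 : R, 1 <= p1 -> 1 <= p2 -> p1 != p2 ->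
    (bmo_coincide mu p1 p2 <-> Num.max p1 p2 < p0).

Definition caseC (R : realType) (T : pointedType) (rho : T -> T -> R)
  (mu : {measure set (borelT rho) -> \bar R}) (p0 : R) : Prop :=
  1 <= p0 /\
  forall p1 p2 : R, 1 <= p1 -> 1 <= p2 -> p1 != p2 ->
    (bmo_coincide mu p1 p2 <-> Num.max p1 p2 <= p0).

Definition exactly_one3 (P Q S : Prop) : Prop :=
  [/\ P \/ Q \/ S, ~ (P /\ Q), ~ (P /\ S) & ~ (Q /\ S)].

(* Main.v *)
Require Import Defs.
From HB Require Import structures.
From mathcomp Require Import all_boot all_order all_algebra.
From mathcomp Require Import all_classical all_reals all_analysis.
From mathcomp Require Import measurable_realfun zify ring lra.
Import Order.TTheory GRing.Theory Num.Theory.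
Import numFieldNormedType.Exports.
Set Implicit Arguments. Unset Strict Implicit. Unset Printing Implicit Defensive.
Local Open Scope classical_set_scope.
Local Open Scope ring_scope.

(* BMO^p decreases with p, so the trichotomy amounts to: if BMO^p is contained
   in BMO^q for some p < q, then BMO^1 = BMO^q.  Let f be in BMO^r with r <= p,
   and put a = r/p.  For every nonnegative 1-Lipschitz d on the line, d(f)^a is
   in BMO^p, hence in BMO^q.  Taking d(t) = |t| and d = distance to a lacunary
   sequence of averages f_B of f over putative bad balls, these two functions
   together control |f - f_B|^a, so that f is in BMO^(rq/p).  Starting from
   r = 1 and iterating, the exponent passes p after finitely many steps.

   The examples live on the natural numbers, with distance 1 between neighbours
   and 2 otherwise: every ball is contained in {x-1, x, x+1} or is the whole
   space.  For slowly varying weights w_i, a function in BMO^1 has bounded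
   increments, so BMO^p = BMO^1 iff sum_i w_i (i+1)^p is finite, and dyadic
   weights with or without a quadratic correction realize (C) and (B). *)

(** * Powers and means *)

Section power.
Variable R : realType.
Implicit Types x y p q C : R.

Lemma le_powR p x y : 0 <= p -> 0 <= x -> x <= y -> x `^ p <= y `^ p.
Proof.
by move=> p0 x0 xy; rewrite ge0_ler_powR// nnegrE// (le_trans x0).
Qed.

Lemma powR_le_1D p q x : 0 <= p <= q -> 0 <= x -> x `^ p <= 1 + x `^ q.
Proof.
move=> /andP[p0 pq] x0; have [x1|/ltW x1] := leP x 1.
  have : x `^ p <= 1 `^ p by apply: le_powR => //; exact: ltW.
  by rewrite powR1 => h; rewrite (le_trans h)// lerDl powR_ge0.
by rewrite (@le_trans _ _ (x `^ q)) ?ler_powR// lerDr.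
Qed.

Lemma powR_add_le p x y : 0 <= p -> 0 <= x -> 0 <= y ->
  (x + y) `^ p <= 2 `^ p * x `^ p + 2 `^ p * y `^ p.
Proof.
move=> p0 x0 y0; rewrite -!powRM//.
have [xy|/ltW xy] := leP x y.
  rewrite (@le_trans _ _ ((2 * y) `^ p)) ?lerDr ?powR_ge0//.
  by apply: le_powR => //; lra.
rewrite (@le_trans _ _ ((2 * x) `^ p)) ?lerDl ?powR_ge0//.
by apply: le_powR => //; lra.
Qed.

(** With s = x + y, each fraction z / s in [0, 1] is at most its p-th power because p <= 1.
    Multiplying by s^p and adding the cases z = x and z = y gives the claim. *)
Lemma powR_subadd p x y : 0 < p <= 1 -> 0 <= x -> 0 <= y ->
  (x + y) `^ p <= x `^ p + y `^ p.
Proof.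
move=> /andP[p0 p1] x0 y0; have [->|xy0] := eqVneq (x + y) 0.
  by rewrite powR0 ?gt_eqF// addr_ge0 ?powR_ge0.
have s0 : 0 < x + y by rewrite lt_def xy0 addr_ge0.
have frac z : 0 <= z <= x + y -> z / (x + y) * (x + y) `^ p <= z `^ p.
  move=> /andP[z0 zs]; have [->|zn0] := eqVneq z 0.
    by rewrite mul0r mul0r powR_ge0.
  have zs0 : 0 <= z / (x + y) by rewrite divr_ge0// ltW.
  rewrite -[X in _ <= X `^ p](divfK (lt0r_neq0 s0)) powRM//; last exact: ltW.
  rewrite ler_wpM2r ?powR_ge0//; apply: ger1_powR => //.
  apply/andP; split; last by rewrite ler_pdivrMr ?mul1r.
  by apply: divr_gt0 => //; rewrite lt_def zn0.
have := lerD (frac x _) (frac y _); rewrite -mulrDl -mulrDl divff// mul1r.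
by apply; rewrite ?x0 ?y0 ?lerDl ?lerDr.
Qed.

Lemma powR_holder p x y : 0 < p <= 1 -> 0 <= x -> 0 <= y ->
  `|x `^ p - y `^ p| <= `|x - y| `^ p.
Proof.
move=> p01; wlog xy : x y / y <= x => [H x0 y0|x0 y0].
  have [yx|/ltW yx] := leP y x; first exact: H.
  by rewrite distrC (distrC x); exact: H.
have p0 : 0 <= p by case/andP: p01 => /ltW.
rewrite [X in _ <= X `^ p]ger0_norm ?subr_ge0// ger0_norm ?subr_ge0; last first.
  by apply: le_powR => //; exact: ltW.
rewrite lerBlDr -[X in X `^ p <= _](subrK y x) powR_subadd// subr_ge0//.
Qed.

End power.

(** * Bounds on means and their transfer along pointwise inequalities *)

Section means.
Context d (T : measurableType d) (R : realType) (mu : {measure set T -> \bar R}).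
Implicit Types (D : set T) (f g h : T -> R) (c p : R).

(** The mean bound is kept free of division and in the extended reals, so bounds combine by
    monotonicity and linearity of the integral. *)
Definition mean_le D g (C : R) : Prop :=
  (\int[mu]_(x in D) (g x)%:E <= C%:E * mu D)%E.

(** This turns pointwise inequalities into inequalities between means; the oscillation estimates
    below only supply the pointwise part. *)
Lemma mean_le_lincomb D g1 g2 h (a b e C1 C2 : R) : measurable D ->
  measurable_fun D g1 -> measurable_fun D g2 -> measurable_fun D h ->
  (forall x, D x -> 0 <= g1 x) -> (forall x, D x -> 0 <= g2 x) ->
  (forall x, D x -> 0 <= h x) -> 0 <= a -> 0 <= b -> 0 <= e ->
  0 <= C1 -> 0 <= C2 ->
  (forall x, D x -> h x <= a * g1 x + b * g2 x + e) ->
  mean_le D g1 C1 -> mean_le D g2 C2 -> mean_le D h (a * C1 + b * C2 + e).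
Proof.
move=> mD mg1 mg2 mh g10 g20 h0 a0 b0 e0 C10 C20 hle H1 H2.
have mZ k g : measurable_fun D g -> measurable_fun D (fun x => (k%:E * (g x)%:E)%E).
  move=> mg; apply/measurable_EFinP => /=.
  exact: measurable_funM.
have H : (\int[mu]_(x in D) (h x)%:E <=
   \int[mu]_(x in D) (a%:E * (g1 x)%:E + b%:E * (g2 x)%:E + e%:E))%E.
  apply: ge0_le_integral => //.
  - exact/measurable_EFinP.
  - by apply: emeasurable_funD => //; apply: emeasurable_funD; exact: mZ.
have z0 k g : 0 <= k -> (forall x, D x -> 0 <= g x) ->
    forall x, D x -> (0 <= k%:E * (g x)%:E)%E.
  by move=> k0 g0 x Dx; rewrite -EFinM lee_fin mulr_ge0// g0.
have me g : measurable_fun D g -> measurable_fun D (EFin \o g).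
  by move=> mg; apply/measurable_EFinP.
apply: (le_trans H); rewrite ge0_integralD//; [|
  by move=> x Dx; rewrite adde_ge0// z0|
  by apply: emeasurable_funD; exact: mZ].
rewrite ge0_integralD//; [|exact: z0|exact: mZ|exact: z0|exact: mZ].
rewrite !ge0_integralZl_EFin//; [|exact: me|exact: me].
rewrite (integral_cst mu mD) !EFinD !EFinM ge0_muleDl; first last.
- by rewrite lee_fin.
- by rewrite -!EFinM -EFinD lee_fin addr_ge0// mulr_ge0.
rewrite ge0_muleDl; first last.
- by rewrite -!EFinM lee_fin mulr_ge0.
- by rewrite -!EFinM lee_fin mulr_ge0.
by rewrite !leeD// -muleA lee_wpmul2l// lee_fin.
Qed.

Let integral_EFin_cst D c : measurable D ->
  (\int[mu]_(x in D) (@cst T R c x)%:E = c%:E * mu D)%E.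
Proof. by move=> mD; rewrite -(integral_cst mu mD). Qed.

Lemma cst_mean_le D c C : measurable D -> (0 < mu D < +oo)%E ->
  mean_le D (cst c) C -> c <= C.
Proof.
move=> mD /andP[D0 Doo]; rewrite /mean_le integral_EFin_cst//.
have mf : mu D \is a fin_num by rewrite ge0_fin_numE// ltW.
have m0 : 0 < fine (mu D) by rewrite fine_gt0 ?D0.
by rewrite -(fineK mf) -!EFinM lee_fin ler_pM2r.
Qed.

Lemma mean_leW D g C C' : C <= C' -> mean_le D g C -> mean_le D g C'.
Proof. by move=> CC' /le_trans; apply; rewrite lee_wpmul2r ?lee_fin. Qed.

Lemma mean_le_affine D g h (a e C : R) : measurable D ->
  measurable_fun D g -> measurable_fun D h ->
  (forall x, D x -> 0 <= g x) ->
  (forall x, D x -> 0 <= h x) -> 0 <= a -> 0 <= e -> 0 <= C ->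
  (forall x, D x -> h x <= a * g x + e) ->
  mean_le D g C -> mean_le D h (a * C + e).
Proof.
move=> mD mg mh g0 h0 a0 e0 C0 H Hg.
have := @mean_le_lincomb D g g h a 0 e C C mD mg mg mh g0 g0 h0 a0 (lexx _) e0 C0 C0.
by rewrite mul0r addr0; apply => // x Dx; rewrite mul0r addr0 H.
Qed.

Lemma mean_le_cst D c : measurable D -> mean_le D (cst c) c.
Proof. by move=> mD; rewrite /mean_le integral_EFin_cst//. Qed.

Lemma measurable_osc D f c p : measurable_fun D f ->
  measurable_fun D (fun x => `|f x - c| `^ p).
Proof.
move=> mf; apply: (measurableT_comp (@measurable_powR R p)).
apply: measurableT_comp => //.
exact: measurable_funB.
Qed.

(* [c] and [c'] are close because |c - c'| <= |f - c| + |f - c'| on average. *)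
Lemma mean_le_recenter D f c c' p q C C' : measurable D -> (0 < mu D < +oo)%E ->
  measurable_fun D f -> 1 <= p -> 1 <= q -> 0 <= C -> 0 <= C' ->
  mean_le D (fun x => `|f x - c| `^ p) C ->
  mean_le D (fun x => `|f x - c'| `^ q) C' ->
  mean_le D (fun x => `|f x - c'| `^ p) (2 `^ p * C + 2 `^ p * (2 + C + C') `^ p).
Proof.
move=> mD muD mf p1 q1 C0 C'0 Hc Hc'.
have p0 : 0 <= p by lra.
(* The 2 pays for bounding both first powers, by 1 plus a p-th power and by 1 plus a q-th power. *)
have cc' : `|c - c'| <= 2 + C + C'.
  apply: (cst_mean_le mD muD).
  have -> : 2 + C + C' = 1 * C + 1 * C' + 2 by lra.
  apply: mean_le_lincomb Hc Hc' => //; try exact: measurable_osc;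
    try by move=> *; exact: powR_ge0.
  move=> x Dx; rewrite !mul1r /cst.
  have a1 : `|f x - c| <= 1 + `|f x - c| `^ p.
    by rewrite -{1}(@powRr1 _ `|_|)//; apply: powR_le_1D; rewrite // p1 ler01.
  have a2 : `|f x - c'| <= 1 + `|f x - c'| `^ q.
    by rewrite -{1}(@powRr1 _ `|_|)//; apply: powR_le_1D; rewrite // q1 ler01.
  have := ler_distD (f x) c c'; rewrite (distrC c (f x)); lra.
apply: mean_le_affine Hc => //; try exact: measurable_osc;
    try by move=> *; exact: powR_ge0.
  by rewrite mulr_ge0 ?powR_ge0.
move=> x Dx; apply: le_trans (powR_add_le _ _ _) => //; last by lra.
apply: le_powR => //.
by apply: (le_trans (ler_distD c _ _)); rewrite lerD2l.
Qed.

End means.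

(** * BMO through arbitrary centres *)

Section bmo.
Variables (R : realType) (T : pointedType) (rho : T -> T -> R).
Hypothesis rho_metric : is_metric rho.
Variable mu : {measure set (borelT rho) -> \bar R}.
Implicit Types (f : T -> R) (p C : R) (B : set T).

Lemma measurable_mball x (r : R) :
  measurable (mball rho x r : set (borelT rho)).
Proof.
apply: sub_sigma_algebra => y; rewrite /mball /= => xyr.
exists (r - rho x y); first by rewrite subr_gt0.
move=> z; rewrite /mball /= => yz; case: rho_metric => _ _ _ tri.
by rewrite (le_lt_trans (tri _ y _))// -ltrBrDl.
Qed.

Lemma measurable_admissible B :
  admissible_ball mu B -> measurable (B : set (borelT rho)).
Proof. by move=> [x [r [_ [-> _]]]]; exact: measurable_mball. Qed.

Lemma admissible_fin B : admissible_ball mu B ->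
  mu B = (fine (mu B))%:E /\ 0 < fine (mu B).
Proof.
move=> [x [r [_ [_ /andP[B0 Boo]]]]].
by rewrite fine_gt0 ?B0// fineK// ge0_fin_numE// ltW.
Qed.

Lemma admissible_lty B : admissible_ball mu B -> (0 < mu B < +oo)%E.
Proof. by move=> [x [r [_ []]]]. Qed.

Lemma loc_integrableW f B : loc_integrable mu f -> admissible_ball mu B ->
  mu.-integrable (B : set (borelT rho)) (EFin \o f).
Proof.
by move=> + [x [r [r0 [-> /andP[_ Boo]]]]]; apply.
Qed.

Lemma loc_integrable_measurable f B :
  loc_integrable mu f -> admissible_ball mu B ->
  measurable_fun (B : set (borelT rho)) f.
Proof.
move=> fi aB; apply/measurable_EFinP.
exact: measurable_int (loc_integrableW fi aB).
Qed.

Lemma integrable_EFin_cst (D : set (borelT rho)) (c : R) : measurable D ->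
  (mu D < +oo)%E -> mu.-integrable D (EFin \o cst c).
Proof.
move=> mD Doo; apply/integrableP; split; first exact/measurable_EFinP.
by rewrite (integral_cst mu mD `|c|%:E) lte_mul_pinfty.
Qed.

(** Each ball may have its own centre in place of the average, and the root 1/p is dropped. For
    locally integrable functions this still describes BMO^p, see [BMOP]. *)
Definition bounded_osc p f := exists2 C, 0 <= C &
  forall B, admissible_ball mu B ->
    exists c, mean_le mu (B : set (borelT rho)) (fun x => `|f x - c| `^ p) C.

(** The distance from the average to c is at most the mean of |f - c|, and t <= 1 + t^p bounds that
    mean by C + 1. *)
Lemma ball_avg_dist p f B c C : loc_integrable mu f -> admissible_ball mu B ->
  1 <= p -> 0 <= C ->
  mean_le mu (B : set (borelT rho)) (fun x => `|f x - c| `^ p) C ->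
  `|ball_avg mu f B - c| <= C + 1.
Proof.
move=> fi aB p1 C0 H; have mB := measurable_admissible aB.
have mf := loc_integrable_measurable fi aB.
have [mBE mB0] := admissible_fin aB.
have fiB := loc_integrableW fi aB.
have : mean_le mu (B : set (borelT rho)) (fun x => `|f x - c|) (1 * C + 1).
  apply: mean_le_affine H => //; first exact: measurable_osc.
    by apply: measurableT_comp => //; exact: measurable_funB.
  move=> x _; rewrite mul1r [leRHS]addrC -{1}(@powRr1 _ `|_|)//.
  by apply: powR_le_1D; rewrite // ler01.
rewrite mul1r /mean_le => H1.
have ci : mu.-integrable (B : set (borelT rho)) (EFin \o cst c).
  by apply: integrable_EFin_cst => //; case/andP: (admissible_lty aB).
have := le_abse_integral mu mB (f := fun x => (f x)%:E - (cst c x)%:E)%E.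
rewrite integralB_EFin// (integral_cst mu mB c%:E) mBE.
rewrite -(fineK (integrable_fin_num mB fiB)) => H2.
have {H2} : (`|(fine (\int[mu]_(x in (B : set (borelT rho))) (EFin \o f) x))%:E -
     c%:E * (fine (mu B))%:E| <= ((C + 1) * fine (mu B))%:E)%E.
  apply: (le_trans (H2 _)); last by rewrite EFinM -mBE.
  apply: emeasurable_funB; exact/measurable_EFinP.
rewrite -EFinM -EFinB abse_EFin lee_fin => H2.
rewrite /ball_avg -(ler_pM2r mB0); apply: le_trans H2.
rewrite -[X in _ * X](gtr0_norm mB0) -normrM mulrBl mulrAC mulVf ?gt_eqF// mul1r//.
Qed.

Lemma mean_osc_le p f B C : admissible_ball mu B -> 1 <= p -> 0 <= C ->
  (mean_osc mu p f B <= C%:E)%E <->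
  mean_le mu (B : set (borelT rho)) (fun x => `|f x - ball_avg mu f B| `^ p) (C `^ p).
Proof.
move=> aB p1 C0; rewrite /mean_le /mean_osc.
have [mBE mB0] := admissible_fin aB.
have p0 : p != 0 by rewrite gt_eqF// (lt_le_trans _ p1).
set J := integral _ _ _.
have J0 : (0 <= J)%E by apply: integral_ge0 => x _; rewrite lee_fin powR_ge0.
have A0 : (0 <= (fine (mu B))^-1%:E * J)%E.
  by rewrite mule_ge0// lee_fin invr_ge0 ltW.
have E : (((fine (mu B))^-1%:E * J <= (C `^ p)%:E) <->
          (J <= (C `^ p)%:E * mu B))%E.
  by rewrite [X in (X <= _)%E <-> _]muleC lee_pdivrMr// -mBE.
split=> H.
  apply/E; rewrite -[leLHS]poweRe1// -(mulVf p0) poweRrM -poweR_EFin.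
  by apply: gt0_ler_poweR; rewrite ?in_itv/= ?poweR_ge0 ?leey ?lee_fin ?C0//; lra.
rewrite -[leRHS]poweRe1 ?lee_fin// -(mulfV p0) poweRrM poweR_EFin.
apply: gt0_ler_poweR; rewrite ?in_itv/= ?A0 ?leey ?lee_fin ?powR_ge0//.
  by rewrite invr_ge0 (le_trans _ p1).
by apply/E.
Qed.

Lemma BMO_avg p f : 1 <= p -> BMO mu p f ->
  exists2 C, 0 <= C & forall B, admissible_ball mu B ->
    mean_le mu (B : set (borelT rho)) (fun x => `|f x - ball_avg mu f B| `^ p) C.
Proof.
move=> p1 [fi H].
(* Without admissible balls the norm is the supremum of the empty set, -oo; the maximum with 0 gives
   a nonnegative bound in every case. *)
exists ((Num.max 0 (fine (bmo_norm mu p f))) `^ p); first exact: powR_ge0.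
move=> B aB.
apply/mean_osc_le => //; first by rewrite le_max lexx.
have : (mean_osc mu p f B <= bmo_norm mu p f)%E.
  by apply: ereal_sup_ubound; exists B.
move=> h; apply: (le_trans h).
case: (bmo_norm mu p f) H => [r| |]//= _; last exact: leNye.
by rewrite lee_fin le_max lexx orbT.
Qed.

(** The average lies within C + 1 of any centre that satisfies the bound C, so passing from that
    centre to the average only changes the constant, to [K]. *)
Lemma BMOP p f : 1 <= p ->
  BMO mu p f <-> loc_integrable mu f /\ bounded_osc p f.
Proof.
move=> p1; split=> [fp|[fi H]]; split=> //; first by case: fp.
  have [C C0 H] := BMO_avg p1 fp; exists C => // B aB.
  by exists (ball_avg mu f B); exact: H.
case: H => C C0 H.
pose K := 2 `^ p * C + 2 `^ p * (C + 1) `^ p.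
have K0 : 0 <= K by rewrite addr_ge0// mulr_ge0// powR_ge0.
apply: (@le_lt_trans _ _ (K `^ p^-1)%:E); last exact: ltry.
apply: ge_ereal_sup => _ [B aB <-]; apply/mean_osc_le => //; first exact: powR_ge0.
rewrite -powRrM mulVf ?gt_eqF ?(lt_le_trans _ p1)// powRr1//.
have [c Hc] := H _ aB.
have mB := measurable_admissible aB.
have mf := loc_integrable_measurable fi aB.
have ac := ball_avg_dist fi aB p1 C0 Hc.
apply: mean_le_affine Hc => //; try exact: measurable_osc;
    try by move=> *; exact: powR_ge0.
  by rewrite mulr_ge0 ?powR_ge0.
move=> x _; apply: le_trans (powR_add_le _ _ _) => //; last first.
- by rewrite addr_ge0.
- by rewrite (le_trans _ p1).
apply: le_powR => //; first by rewrite (le_trans _ p1).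
by apply: (le_trans (ler_distD c _ _)); rewrite lerD2l distrC.
Qed.

End bmo.

(** * Composition with Hoelder functions *)

Lemma lipschitz1_measurable (R : realType) (d : R -> R) :
  (forall s t, `|d s - d t| <= `|s - t|) -> measurable_fun [set: R] d.
Proof.
move=> lip; apply: continuous_measurable_fun => x.
apply/cvgrPdist_le => e e0.
have /cvgrPdist_le/(_ e e0) : (id : R -> R) t @[t --> x] --> x by exact: cvg_id.
by apply: filterS => t; exact: le_trans.
Qed.

Section inclusions.
Variables (R : realType) (T : pointedType) (rho : T -> T -> R).
Hypothesis rho_metric : is_metric rho.
Variable mu : {measure set (borelT rho) -> \bar R}.
Implicit Types (f : T -> R) (p C : R) (B : set T).

(** Keep the centres and use t^p <= 1 + t^q. *)
Lemma BMO_decreasing p q : 1 <= p -> p <= q -> BMO mu q `<=` BMO mu p.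
Proof.
move=> p1 pq f fq; have q1 := le_trans p1 pq.
have [fi [C C0 H]] : loc_integrable mu f /\ bounded_osc mu q f by apply/BMOP.
apply/BMOP => //; split => //.
exists (1 * C + 1); first by rewrite addr_ge0 ?mulr_ge0.
move=> B aB; have [c Hc] := H _ aB; exists c.
have mB := measurable_admissible rho_metric aB.
have mf := loc_integrable_measurable fi aB.
apply: mean_le_affine Hc => //; try exact: measurable_osc.
by move=> x _; rewrite mul1r [leRHS]addrC powR_le_1D// pq andbT; lra.
Qed.

Lemma loc_integrable_opp f :
  loc_integrable mu f -> loc_integrable mu (fun x => - f x).
Proof.
move=> fi x r r0 roo; have := integrableN (fi x r r0 roo).
by apply: eq_integrable => //; exact: measurable_mball.
Qed.

Section holder_composition.
Variables (d : R -> R) (a : R).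
Hypothesis d0 : forall t, 0 <= d t.
Hypothesis dlip : forall s t, `|d s - d t| <= `|s - t|.
Hypothesis a01 : 0 < a <= 1.
Let g f (x : T) := d (f x) `^ a.

Let mg (D : set (borelT rho)) f : measurable_fun D f -> measurable_fun D (g f).
Proof.
move=> mf; apply: (measurableT_comp (@measurable_powR R a)).
by apply: measurableT_comp => //; exact: lipschitz1_measurable.
Qed.

(** Dominate d(f)^a by 1 + d(f), hence by 1 + d(0) + |f|, which is integrable on balls of finite
    measure. *)
Lemma loc_integrable_holder f : loc_integrable mu f -> loc_integrable mu (g f).
Proof.
move=> fi x r r0 roo; have mD := measurable_mball rho_metric x r.
have fx := fi x r r0 roo.
have mf : measurable_fun (mball rho x r : set (borelT rho)) f.
  by apply/measurable_EFinP; exact: measurable_int fx.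
have H : mu.-integrable (mball rho x r : set (borelT rho))
    ((abse \o (EFin \o f)) \+ (EFin \o cst (1 + d 0)%R))%E.
  apply: integrableD => //; first exact: integrable_abse.
  exact: integrable_EFin_cst.
apply: le_integrable H => //; first by apply/measurable_EFinP; exact: mg.
move=> y Dy /=; rewrite lee_fin ger0_norm ?powR_ge0// ger0_norm; last first.
  by rewrite !addr_ge0.
have h1 : g f y <= 1 + d (f y).
  rewrite -[X in _ <= 1 + X]powRr1//; apply: powR_le_1D => //.
  by case/andP: a01 => /ltW -> ->.
have := dlip (f y) 0; rewrite subr0 => h2.
have := ler_norm (d (f y) - d 0); lra.
Qed.

(** Since |d(f)^a - d(c)^a| <= |f - c|^a and ap = r, the r-th mean of f controls the p-th mean of
    d(f)^a. The inclusion then yields a q-th mean around an unknown centre, which [mean_le_recenter]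
    moves back to d(c)^a. *)
Lemma BMO_holder (r p q : R) f (c : set T -> R) C : 1 <= r -> 1 <= p ->
  1 <= q -> a * p = r -> BMO mu p `<=` BMO mu q -> loc_integrable mu f ->
  0 <= C ->
  (forall B, admissible_ball mu B ->
    mean_le mu (B : set (borelT rho)) (fun x => `|f x - c B| `^ r) C) ->
  exists2 C', 0 <= C' & forall B, admissible_ball mu B ->
    mean_le mu (B : set (borelT rho))
      (fun x => `|g f x - d (c B) `^ a| `^ q) C'.
Proof.
move=> r1 p1 q1 apr pq fi C0 H.
have gi := loc_integrable_holder fi.
have Hp B : admissible_ball mu B -> mean_le mu (B : set (borelT rho))
      (fun x => `|g f x - d (c B) `^ a| `^ p) C.
  move=> aB; have mB := measurable_admissible rho_metric aB.
  have mf := loc_integrable_measurable fi aB.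
  have -> : C = 1 * C + 0 by lra.
  apply: mean_le_affine (H _ aB) => //; try exact: measurable_osc.
    by apply: measurable_osc; exact: mg.
  move=> x _; rewrite addr0 mul1r -apr powRrM; apply: le_powR => //.
    by rewrite (le_trans _ p1).
  rewrite (le_trans (powR_holder _ _ _))//; apply: le_powR => //.
  by case/andP: a01 => /ltW.
have : BMO mu q (g f).
  apply: pq; apply/BMOP => //; split=> //; exists C => // B aB.
  by exists (d (c B) `^ a); exact: Hp.
move=> /(BMOP rho_metric mu (g f) q1)[_ [C' C'0 H']].
exists (2 `^ q * C' + 2 `^ q * (2 + C' + C) `^ q).
  by rewrite addr_ge0 ?mulr_ge0 ?powR_ge0.
move=> B aB; have [b Hb] := H' _ aB.
have mB := measurable_admissible rho_metric aB.
have mf := loc_integrable_measurable gi aB.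
exact: (mean_le_recenter mB (admissible_lty aB) mf q1 p1 C'0 C0 Hb (Hp _ aB)).
Qed.

End holder_composition.
End inclusions.

(** * Lacunary sequences *)

Section distance_to_sequence.
Variables (R : realType) (m : nat -> R).
Implicit Types (s t : R).

Definition seq_dist t := inf (range (fun k => `|t - m k|)).

Let has_inf_dist t : has_inf (range (fun k => `|t - m k|)).
Proof.
split; first by exists `|t - m 0%N|; exists 0%N.
by exists 0 => _ [k _ <-].
Qed.

Lemma le_seq_dist t (e : R) : (forall k, e <= `|t - m k|) -> e <= seq_dist t.
Proof.
move=> H; apply: lb_le_inf; first by have [] := has_inf_dist t.
by move=> _ [k _ <-].
Qed.

Lemma seq_dist_le t k : seq_dist t <= `|t - m k|.
Proof. by apply: ge_inf; [have [] := has_inf_dist t | exists k]. Qed.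

Lemma seq_dist_ge0 t : 0 <= seq_dist t.
Proof. exact: le_seq_dist. Qed.

Lemma seq_dist_id k : seq_dist (m k) = 0.
Proof.
apply/eqP; rewrite eq_le seq_dist_ge0 andbT.
by have := seq_dist_le (m k) k; rewrite subrr normr0.
Qed.

Lemma seq_dist_lip s t : `|seq_dist s - seq_dist t| <= `|s - t|.
Proof.
have H u v : seq_dist u - `|u - v| <= seq_dist v.
  apply: le_seq_dist => k; rewrite lerBlDl.
  rewrite (le_trans (seq_dist_le u k))//.
  exact: ler_distD.
by have := H s t; have := H t s; rewrite (distrC t) => h1 h2; rewrite ler_norml; lra.
Qed.

Hypothesis m0 : 1 <= m 0%N.
Hypothesis mS : forall k, 8 * m k <= m k.+1.

Lemma sparse_gt0 k : 0 < m k.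
Proof.
elim: k => [|k IH]; first by rewrite (lt_le_trans _ m0).
by have := mS k; lra.
Qed.

Lemma sparse_lt j k : (j < k)%N -> 8 * m j <= m k.
Proof.
elim: k => // k IH; rewrite ltnS leq_eqVlt => /orP[/eqP ->//|/IH h].
by have := mS k; have := sparse_gt0 k; lra.
Qed.

(** For positive t the factor 8 keeps the other terms at distance at least 3/8 of [m k] from t,
    while |t - m k| <= m k. For negative t every term is farther than |t|, and |t - m k| < 3|t|. *)
Lemma seq_dist_far t k : m k < 2 * `|t| -> `|t| < 2 * m k ->
  `|t - m k| <= 4 * seq_dist t.
Proof.
move=> h1 h2; have mk := sparse_gt0 k.
suff : `|t - m k| / 4 <= seq_dist t by lra.
apply: le_seq_dist => j; have mj := sparse_gt0 j.
have [t0|t0] := leP 0 t.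
  move: h1 h2; rewrite (ger0_norm t0) => h1 h2.
  have h3 : `|t - m k| <= m k by rewrite ler_norml; lra.
  have [jk|kj|->] := ltngtP j k.
  - by have := sparse_lt jk; have := ler_norm (t - m j); lra.
  - by have := sparse_lt kj; have := ler_norm (m j - t); rewrite distrC; lra.
  - by have := normr_ge0 (t - m k); lra.
move: h1 h2; rewrite !ltr0_norm//; try lra.
Qed.

(** If |t| and [m k] differ by a factor of at least 2, the difference of their a-th powers suffices.
    Otherwise |t| lies in the window of [seq_dist_far], and the distance to the sequence suffices;
    it also detects t near -m k, which the first term misses. *)
Lemma sparse_separation (a : R) k t : 0 < a <= 1 ->
  `|t - m k| `^ a <= (4 + 2 / (1 - 2^-1 `^ a)) *
    (`| `|t| `^ a - m k `^ a| + seq_dist t `^ a).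
Proof.
move=> /andP[a0 a1].
have mk := sparse_gt0 k.
have half : (2^-1 : R) `^ a < 1.
  have -> : (2^-1 : R) `^ a < 1 = (2^-1 `^ a < 1 `^ a) by rewrite powR1.
  by apply: gt0_ltr_powR; rewrite ?nnegrE// invf_lt1 ?ltr1n.
set kap := 1 - _; have kap0 : 0 < kap by rewrite subr_gt0.
have two : forall x : R, 0 <= x -> (2 * x) `^ a <= 2 * x `^ a.
  by move=> x x0; rewrite powRM// ler_wpM2r ?powR_ge0// ler1_powR//; lra.
have u0 := normr_ge0 (`|t| `^ a - m k `^ a).
have v0 := powR_ge0 (seq_dist t) a.
have B0 : 0 <= 2 / kap by rewrite divr_ge0// ltW.
have Bu0 := mulr_ge0 B0 u0; have Bv0 := mulr_ge0 B0 v0.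
(* From 2x <= y follows x^a <= 2^(-a) y^a, so y^a - x^a is at least [kap] times y^a. *)
have gap x y : 0 <= x -> 2 * x <= y -> `|t - m k| <= 2 * y ->
    `|t - m k| `^ a <= 2 / kap * `|y `^ a - x `^ a|.
  move=> x0 xy ty; have y0 : 0 <= y by lra.
  apply: (@le_trans _ _ (2 * y `^ a)).
    by rewrite (le_trans _ (two _ y0))// le_powR// ltW.
  rewrite -mulrA ler_pM2l// ler_pdivlMl//.
  rewrite (le_trans _ (ler_norm _))// /kap mulrBl mul1r lerD2l lerN2.
  by rewrite -powRM// le_powR//; lra.
have [h1|h1] := leP (2 * `|t|) (m k).
  have := gap `|t| (m k) (normr_ge0 _) h1; rewrite (distrC (m k `^ a)) => H.
  apply: (le_trans (H _)).
    by rewrite (le_trans (ler_normB _ _))// (gtr0_norm mk); have := normr_ge0 t; lra.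
  by nra.
have [h2|h2] := leP (2 * m k) `|t|.
  have H := gap (m k) `|t| (ltW mk) h2.
  apply: (le_trans (H _)).
    by rewrite (le_trans (ler_normB _ _))// (gtr0_norm mk); have := normr_ge0 t; lra.
  by nra.
have h := seq_dist_far h1 h2.
apply: (@le_trans _ _ (4 * seq_dist t `^ a)); last by nra.
apply: (@le_trans _ _ ((2 * (2 * seq_dist t)) `^ a)).
  by apply: le_powR => //; [exact: ltW|lra].
have s0 := seq_dist_ge0 t.
have := two (2 * seq_dist t); have := two (seq_dist t); lra.
Qed.

End distance_to_sequence.

(** * Self-improvement and the trichotomy *)

Section self_improvement.
Variables (R : realType) (T : pointedType) (rho : T -> T -> R).
Hypothesis rho_metric : is_metric rho.
Variable mu : {measure set (borelT rho) -> \bar R}.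
Implicit Types (f : T -> R) (p C : R) (B : set T).

(* Balls with bounded centre are handled by d = |.| alone, so a failure produces
   bad balls with arbitrarily large centres [c B]; once these are chosen
   lacunary, [seq_dist] vanishes at all of them and separates nearby points. *)
Lemma self_improve_center (p q a : R) f (c : set T -> R) C :
  1 <= p -> 1 <= q -> 0 < a <= 1 -> 1 <= a * p ->
  BMO mu p `<=` BMO mu q -> loc_integrable mu f -> 0 <= C ->
  (forall B, admissible_ball mu B ->
    mean_le mu (B : set (borelT rho)) (fun x => `|f x - c B| `^ (a * p)) C) ->
  exists2 C', 0 <= C' & forall B, admissible_ball mu B -> 0 <= c B ->
    mean_le mu (B : set (borelT rho)) (fun x => `|f x - c B| `^ (a * q)) C'.
Proof.
move=> p1 q1 a01 ap1 pq fi C0 H; have /andP[a0 a1] := a01.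
have q0 : 0 <= q by lra.
have a0' : 0 <= a by lra.
have mf B : admissible_ball mu B -> measurable_fun (B : set (borelT rho)) f.
  exact: loc_integrable_measurable.
have mB B : admissible_ball mu B -> measurable (B : set (borelT rho)).
  exact: measurable_admissible.
have holder d : (forall t, 0 <= d t) -> (forall s t, `|d s - d t| <= `|s - t|) ->
    exists2 C', 0 <= C' & forall B, admissible_ball mu B ->
    mean_le mu (B : set (borelT rho))
      (fun x => `|d (f x) `^ a - d (c B) `^ a| `^ q) C'.
  move=> d0 dlip; exact: (BMO_holder rho_metric d0 dlip a01 ap1 p1 q1 erefl pq fi C0 H).
have mh d B b : (forall s t, `|d s - d t| <= `|s - t|) -> admissible_ball mu B ->
    measurable_fun (B : set (borelT rho)) (fun x => `|d (f x) `^ a - b| `^ q).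
  move=> dlip aB; apply: measurable_osc.
  apply: (measurableT_comp (@measurable_powR R a)).
  by apply: measurableT_comp; [exact: lipschitz1_measurable | exact: mf].
have [C1 C10 H1] := holder Num.norm (@normr_ge0 _ _) (@ler_dist_dist _ _).
(* Subadditivity gives |f - c|^a <= |f|^a + |c|^a, and this is at most the oscillation of |f|^a
   around |c|^a plus 2 D^a. *)
have small D : exists2 C', 0 <= C' & forall B, admissible_ball mu B ->
    `|c B| <= D -> mean_le mu (B : set (borelT rho)) (fun x => `|f x - c B| `^ (a * q)) C'.
  exists (2 `^ q * C1 + 2 `^ q * (2 * D `^ a) `^ q).
    by rewrite addr_ge0 ?mulr_ge0 ?powR_ge0.
  move=> B aB cD.
  apply: mean_le_affine (H1 B aB) => //; [exact: mB|exact: (mh _ _ _ (@ler_dist_dist _ _))|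
    by apply: measurable_osc; exact: mf| by rewrite mulr_ge0 ?powR_ge0|].
  move=> x _; rewrite powRrM.
  apply: le_trans (powR_add_le _ _ _) => //; last by rewrite mulr_ge0 ?powR_ge0.
  apply: le_powR => //.
  have h1 : `|f x - c B| `^ a <= (`|f x| + `|c B|) `^ a.
    by apply: le_powR => //; exact: ler_normB.
  have h2 := powR_subadd a01 (normr_ge0 (f x)) (normr_ge0 (c B)).
  have h3 := ler_norm (`|f x| `^ a - `|c B| `^ a).
  have h4 : `|c B| `^ a <= D `^ a by exact: le_powR.
  lra.
apply: contrapT => nb.
(* Were all balls with centre at least D good for the bound k, [small D] would cover the others and
   a uniform bound would exist. *)
have big (Dk : R * R) : exists B, [/\ admissible_ball mu B, Dk.1 <= c B &
    ~ mean_le mu (B : set (borelT rho)) (fun x => `|f x - c B| `^ (a * q)) Dk.2].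
  case: Dk => D k /=; apply: contrapT => /forallNP nB.
  have [C' C'0 H'] := small D; apply: nb; exists (Num.max C' k).
    by rewrite le_max C'0.
  move=> B aB cB0; have [DcB|/ltW cBD] := leP D (c B).
    apply: contrapT => nm; apply: (nB B); split => // h; apply: nm.
    by apply: mean_leW h; rewrite le_max lexx orbT.
  apply: mean_leW (H' B aB _); first by rewrite le_max lexx.
  by rewrite ger0_norm.
have [F HF] := choice big.
(* Each new bad ball has centre at least 8 times the previous one and violates the next integer
   bound; starting from 1 makes the centres positive. *)
pose Bk := fix Bk k := match k with
  | 0%N => F (1, 0)
  | k'.+1 => F (8 * c (Bk k'), k'.+1%:R)
  end.
pose m k := c (Bk k).
have [aB0 m0 nm0] := HF (1, 0).
have HS k := HF (8 * c (Bk k), k.+1%:R).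
have aBk k : admissible_ball mu (Bk k) by case: k => [|k] //=; have [] := HS k.
have mS k : 8 * m k <= m k.+1 by have [] := HS k.
have nmk k : ~ mean_le mu (Bk k : set (borelT rho))
    (fun x => `|f x - m k| `^ (a * q)) k%:R.
  by case: k => [|k] //; have [] := HS k.
have [C2 C20 H2] := holder (seq_dist m) (seq_dist_ge0 m) (seq_dist_lip m).
pose K : R := 4 + 2 / (1 - 2^-1 `^ a).
(* [K] is the constant of [sparse_separation], and 2^q comes from raising its two-term sum to the
   power q. The resulting bound does not depend on k, so the bad ball with index k > M gives the
   contradiction. *)
pose M := K `^ q * 2 `^ q * C1 + K `^ q * 2 `^ q * C2 + 0.
have K0 : 0 <= K.
  have : (2^-1 : R) `^ a <= 1 `^ a by apply: le_powR => //; rewrite invf_le1 ?ler1n.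
  rewrite powR1 => half.
  by rewrite addr_ge0// divr_ge0// subr_ge0.
have M0 : 0 <= M by rewrite !addr_ge0// !mulr_ge0 ?powR_ge0.
pose k := Num.bound M.
apply: (nmk k); apply: (@mean_leW _ _ _ _ _ _ M); first exact: ltW (archi_boundP M0).
apply: mean_le_lincomb (H1 _ (aBk k)) (H2 _ (aBk k)) => //;
  [exact: mB|exact: (mh _ _ _ (@ler_dist_dist _ _))|
   exact: (mh _ _ _ (seq_dist_lip m))|
   by apply: measurable_osc; exact: mf|
   by rewrite mulr_ge0 ?powR_ge0|by rewrite mulr_ge0 ?powR_ge0|].
move=> x _; rewrite addr0 -!mulrA -mulrDr powRrM.
(* The centre [m k] is a term of the sequence, so its [seq_dist] is 0 and the second mean is that of
   a power of [seq_dist m (f x)] itself. *)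
rewrite -/(m k) seq_dist_id powR0 ?gt_eqF// subr0 (gtr0_norm (sparse_gt0 m0 mS k)).
rewrite (ger0_norm (powR_ge0 _ _)).
apply: le_trans (ler_wpM2l (powR_ge0 _ _) (powR_add_le _ _ _)) => //.
  rewrite -powRM// ?addr_ge0 ?powR_ge0//; apply: le_powR => //.
  exact: sparse_separation.
by rewrite powR_ge0.
Qed.

(** [self_improve_center] handles balls with nonnegative average; applied to -f with centres -f_B it
    handles the rest. *)
Lemma BMO_self_improve (p q a : R) :
  1 <= p -> 1 <= q -> 0 < a <= 1 -> 1 <= a * p -> 1 <= a * q ->
  BMO mu p `<=` BMO mu q -> BMO mu (a * p) `<=` BMO mu (a * q).
Proof.
move=> p1 q1 a01 ap1 aq1 pq f fp.
have fi : loc_integrable mu f by case: fp.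
have [C C0 H] := BMO_avg ap1 fp.
have [C1 C10 H1] := self_improve_center p1 q1 a01 ap1 pq fi C0 H.
have [||C2 C20 H2] := @self_improve_center p q a (fun x => - f x)
  (fun B => - ball_avg mu f B) C p1 q1 a01 ap1 pq _ C0.
- exact: loc_integrable_opp.
- move=> B aB; have := H B aB; congr mean_le; apply/funext => x.
  by rewrite -opprD normrN.
apply/BMOP => //; split => //; exists (Num.max C1 C2); first by rewrite le_max C10.
move=> B aB; exists (ball_avg mu f B).
have [c0|/ltW c0] := leP 0 (ball_avg mu f B).
  by apply: mean_leW (H1 B aB c0); rewrite le_max lexx.
have := H2 B aB; rewrite oppr_ge0 => /(_ c0).
under eq_fun do rewrite -opprD normrN.
by apply: mean_leW; rewrite le_max lexx orbT.
Qed.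

(** With l = q / p, an inclusion of BMO^1 in BMO^(l^n) with l^n < p improves to exponent l^(n+1) by
    taking a = l^n / p. Once l^n >= p, the given inclusion finishes. *)
Lemma BMO_eq1 (p q : R) : 1 <= p -> p < q ->
  BMO mu p `<=` BMO mu q -> BMO mu 1 `<=` BMO mu q.
Proof.
move=> p1 pq sub; have q1 : 1 <= q by lra.
pose l := q / p; have l1 : 1 < l by rewrite /l ltr_pdivlMr; lra.
have H n : BMO mu 1 `<=` BMO mu q \/ BMO mu 1 `<=` BMO mu (l ^+ n).
  elim: n => [|n [|IH]]; [by right; rewrite expr0|by left|].
  have ln1 : 1 <= l ^+ n by rewrite exprn_ege1// ltW.
  have [pl|lp] := leP p (l ^+ n).
    left; apply: subset_trans sub; apply: subset_trans IH _.
    exact: BMO_decreasing.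
  right; apply: subset_trans IH _.
  have e1 : l ^+ n = (l ^+ n / p) * p by rewrite divfK// gt_eqF; lra.
  have e2 : l ^+ n.+1 = (l ^+ n / p) * q by rewrite exprSr mulrAC -mulrA.
  rewrite e1 e2; apply: BMO_self_improve => //.
  - rewrite divr_gt0 ?ler_pdivrMr ?mul1r /= ?(ltW lp)//; lra.
  - by rewrite -e1.
  - by rewrite -e2 exprn_ege1// ltW.
(* A Bernoulli-type bound n(l - 1) <= l^n makes the powers of l unbounded. *)
have [n pn] : exists n, p <= l ^+ n.
  exists (Num.bound (p / (l - 1))).
  set n := Num.bound _.
  have h : p / (l - 1) < n%:R by apply: archi_boundP; rewrite divr_ge0; lra.
  have : n%:R * (l - 1) <= l ^+ n.
    elim: (n) => [|i IH]; first by rewrite mul0r expr0.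
    have li : 1 <= l ^+ i by rewrite exprn_ege1// ltW.
    by rewrite exprS -natr1; nra.
  by move: h; rewrite ltr_pdivrMr; lra.
case: (H n) => // h; apply: subset_trans sub; apply: subset_trans h _.
exact: BMO_decreasing.
Qed.

(** By [BMO_eq1] two spaces coincide exactly when the larger exponent lies in [S]. As [S] is an
    initial interval of the half-line from 1, it is unbounded (A), omits its supremum (B) or attains
    it (C). *)
Lemma trichotomy : exactly_one3 (caseA mu) (exists p0 : R, caseB mu p0)
                  (exists p0 : R, caseC mu p0).
Proof.
pose S := [set p : R | 1 <= p /\ BMO mu p = BMO mu 1].
have S1 : S 1 by [].
have coincideP (p1 p2 : R) : 1 <= p1 -> 1 <= p2 -> p1 != p2 ->
    bmo_coincide mu p1 p2 <-> S (Num.max p1 p2).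
  wlog p12 : p1 p2 / p1 < p2 => [W|p11 p21 _].
    move=> h1 h2; rewrite neq_lt => /orP[|] h.
      by apply: W => //; rewrite lt_eqF.
    have [|w1 w2] := W p2 p1 h h2 h1; first by rewrite lt_eqF.
    by rewrite maxC; split=> [/esym|/w2/esym].
  rewrite (max_idPr (ltW p12)); split=> [e|[_ e]].
    split => //; apply/seteqP; split; first exact: BMO_decreasing.
    by apply: BMO_eq1 p12 _ => //; rewrite e.
  rewrite /bmo_coincide; apply/seteqP; split; last by apply: BMO_decreasing => //; exact: ltW.
  by rewrite e; exact: BMO_decreasing.
have Sdown p q : 1 <= p -> p <= q -> S q -> S p.
  move=> p1 pq [q1 e]; split => //; apply/seteqP; split; first exact: BMO_decreasing.
  by rewrite -e; exact: BMO_decreasing.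
split.
- have [ub|nub] := pselect (has_ubound S); last first.
    left => p1 p2 h1 h2.
    suff al p : 1 <= p -> BMO mu p = BMO mu 1 by rewrite /bmo_coincide !al.
    move=> hp; apply: contrapT => ne; apply: nub; exists p => q Sq.
    rewrite leNgt; apply/negP => pq; apply: ne.
    by have [] := Sdown p q hp (ltW pq) Sq.
  have hs : has_sup S by split => //; exists 1.
  have s1 : 1 <= sup S by exact: ub_le_sup.
  have below p : 1 <= p -> p < sup S -> S p.
    move=> hp ps; have [q Sq pq] := sup_gt (ex_intro _ 1 S1) ps.
    exact: Sdown hp (ltW pq) Sq.
  right; have [Ss|nSs] := pselect (S (sup S)).
    right; exists (sup S); split => // p1 p2 h1 h2 n12.
    rewrite coincideP//; split; first by move=> ?; exact: ub_le_sup.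
    by move=> h; apply: Sdown Ss => //; rewrite le_max h1.
  left; exists (sup S); split.
    by rewrite lt_neqAle s1 andbT; apply/eqP => e; apply: nSs; rewrite -e.
  move=> p1 p2 h1 h2 n12; rewrite coincideP//; split; last first.
    by apply: below; rewrite le_max h1.
  move=> Sm; rewrite lt_neqAle ub_le_sup// andbT.
  by apply/eqP => e; apply: nSs; rewrite -e.
(* The pair 1, p0 separates (A) from (B); below, the pair 1, p0 + 1 separates (A) from (C). *)
- move=> [A [p0 [h H]]].
  have /H : 1 != p0 by rewrite lt_eqF.
  move=> /(_ (lexx _) (ltW h)) [/(_ (A _ _ (lexx _) (ltW h))) + _].
  by rewrite gt_max ltxx andbF.
- move=> [A [p0 [h H]]].
  have h1 : 1 <= p0 + 1 by lra.
  have /(H _ _ (lexx _) h1) [/(_ (A _ _ (lexx _) h1)) + _] : 1 != p0 + 1 :> R.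
    by apply/eqP; lra.
  by rewrite ge_max; lra.
(* The two thresholds would agree at every p > 1. They fail to do so at p0 itself if p0 <= p0', and
   otherwise at the midpoint between p0 and the larger of p0' and 1. *)
- move=> [[p0 [h H]] [p0' [h' H']]].
  have E p : 1 < p -> p < p0 <-> p <= p0'.
    move=> p1; have n : 1 != p by rewrite lt_eqF.
    have := H _ _ (lexx _) (ltW p1) n; rewrite (H' _ _ (lexx _) (ltW p1) n).
    by rewrite (max_idPr (ltW p1)) => ->.
  have h0 : p0' < p0 by rewrite ltNge; apply/negP => /(E _ h); rewrite ltxx.
  have [h1|h1] := ltP 1 p0'.
    have /E e : 1 < (p0 + p0') / 2 by lra.
    have : (p0 + p0') / 2 <= p0' by apply/e; lra.
    lra.
  have /E e : 1 < (p0 + 1) / 2 by lra.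
  have : (p0 + 1) / 2 <= p0' by apply/e; lra.
  lra.
Qed.

End self_improvement.

(** * Weighted path spaces *)

Lemma nneseries_lty (R : realType) (u : nat -> R) : (forall i, 0 <= u i) ->
  (\sum_(i <oo) (u i)%:E < +oo)%E <->
  exists L, forall n, \sum_(0 <= i < n) u i <= L.
Proof.
move=> u0; split=> [uoo|[L HL]].
  exists (fine (\sum_(i <oo) (u i)%:E)%E) => n.
  rewrite -lee_fin fineK; last first.
    rewrite ge0_fin_numE//; apply: nneseries_ge0 => i _ _; by rewrite lee_fin.
  by rewrite -sumEFin; apply: nneseries_lim_ge => i _ _; rewrite lee_fin.
apply: (@le_lt_trans _ _ L%:E); last exact: ltry.
apply: lime_le; first by apply: is_cvg_nneseries => i _ _; rewrite lee_fin.
by apply: nearW => n; rewrite sumEFin lee_fin.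
Qed.

Section path_space.
Variables (R : realType) (w : nat -> R) (K : R).
Hypothesis w0 : forall i, 0 < w i.
Hypothesis wS : forall i, w i.+1 <= w i.
Hypothesis wK : forall i, w i <= K * w i.+1.

Definition path_dist (i j : nat) : R :=
  if i == j then 0 else if (i == j.+1) || (j == i.+1) then 1 else 2.

(** Nonzero distances are 1 or 2, so two of them always add up to at least the third. *)
Lemma path_dist_metric : is_metric path_dist.
Proof.
split.
- by move=> x y; rewrite /path_dist; do 2 case: ifP => //.
- move=> x y; rewrite /path_dist; case: eqVneq => [->//|ne].
  split; last by move=> e; rewrite e eqxx in ne.
  by case: ifP => _ /eqP; rewrite ?oner_eq0// pnatr_eq0.
- move=> x y; rewrite /path_dist eq_sym; case: eqVneq => //; by rewrite orbC.
- move=> x y z; rewrite /path_dist.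
  have [->|xy] := eqVneq x y; first by rewrite add0r.
  have [<-|yz] := eqVneq y z; first by rewrite addr0 (negbTE xy).
  have h (b b' : bool) : 2 <= (if b then 1 else 2) + (if b' then 1 else 2) :> R.
    by case: b; case: b'; lra.
  apply: le_trans (h _ _); case: ifP => // _; case: ifP => // _; lra.
Qed.

Notation X := (borelT path_dist).

(** Balls of radius 1 are singletons, so every set is open. *)
Lemma path_measurable (A : set X) : measurable A.
Proof.
apply: sub_sigma_algebra => x Ax; exists 1; first exact: ltr01.
move=> y; rewrite /mball /path_dist /=; case: eqVneq => [<-//|_].
by case: ifP => _; lra.
Qed.

Lemma path_measurable_fun (A : set X) d (Y : measurableType d) (f : X -> Y) :
  measurable_fun A f.
Proof. by move=> *; exact: path_measurable. Qed.

Definition path_measure : {measure set X -> \bar R} :=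
  mseries (fun i => mscale (NngNum (ltW (w0 i))) (\d_(i : X))) 0.
Local Notation mu := path_measure.

Lemma path_integral (D : set X) (g : X -> R) : (forall x, 0 <= g x) ->
  (\int[mu]_(x in D) (g x)%:E = \sum_(i <oo) (w i * (\1_D (i : X) * g i))%:E)%E.
Proof.
move=> g0; have mD := path_measurable D.
have mg : measurable_fun D (fun x : X => (g x)%:E) by exact: path_measurable_fun.
have g0' x : D x -> (0 <= (g x)%:E)%E by rewrite lee_fin g0.
rewrite (ge0_integral_measure_series _ mD g0' mg).
apply: eq_eseriesr => i _.
by rewrite (ge0_integral_mscale _ mD _ mg g0') integral_dirac.
Qed.

Lemma path_measureE (D : set X) :
  mu D = (\sum_(i <oo) (w i * \1_D (i : X))%:E)%E.
Proof.
rewrite -[LHS]mul1e -(integral_cst mu (path_measurable D)).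
rewrite (@path_integral D (cst 1) (fun=> ler01)).
by apply: eq_eseriesr => i _; rewrite /= mulr1.
Qed.

Lemma path_measure1 (j : X) : mu [set j] = (w j)%:E.
Proof.
rewrite path_measureE (nneseries_split _ j.+1); last first.
  by move=> k _; rewrite lee_fin mulr_ge0// ltW.
rewrite eseries0 ?adde0; last first.
  move=> i; rewrite add0n => ji _; rewrite indicE memNset ?mulr0//= => e.
  by rewrite e ltnn in ji.
rewrite add0n big_nat_recr//= big_nat big1 ?add0e; last first.
  move=> i ij; rewrite indicE memNset ?mulr0//= => e.
  by rewrite e ltnn in ij.
by rewrite indicE mem_set// mulr1.
Qed.

Lemma path_integral_ge (D : set X) (g : X -> R) (j : X) :
  (forall x, 0 <= g x) -> D j ->
  ((w j * g j)%:E <= \int[mu]_(x in D) (g x)%:E)%E.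
Proof.
move=> g0 Dj; rewrite path_integral//.
have u0 i : 0 <= w i * (\1_D (i : X) * g i) by apply: mulr_ge0; [exact: ltW|rewrite mulr_ge0].
apply: (le_trans _ (nneseries_lim_ge j.+1 _)); last by move=> i _ _; rewrite lee_fin.
rewrite sumEFin lee_fin big_nat_recr//= indicE mem_set// mul1r lerDr.
by rewrite sumr_ge0.
Qed.

(** The shift to i + 1 keeps the powers at least 1 for p >= 0, so a finite moment also bounds the
    total mass. *)
Definition path_moment_finite (p : R) :=
  (\sum_(i <oo) (w i * i.+1%:R `^ p)%:E < +oo)%E.

Lemma path_integral_lty (D : set X) (g : X -> R) (M p : R) :
  path_moment_finite p -> 0 <= M -> (forall x, 0 <= g x) ->
  (forall i : nat, g i <= M * i.+1%:R `^ p) ->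
  (\int[mu]_(x in D) (g x)%:E < +oo)%E.
Proof.
move=> pfin M0 g0 gM; rewrite path_integral//.
apply: (@le_lt_trans _ _ (\sum_(i <oo) (M%:E * (w i * i.+1%:R `^ p)%:E))%E).
  apply: lee_nneseries => i _ => [_|].
    by rewrite lee_fin; apply: mulr_ge0; [exact: ltW|rewrite mulr_ge0].
  rewrite -EFinM lee_fin [leRHS]mulrCA; apply: ler_wpM2l; first exact: ltW.
  apply: le_trans (gM i); rewrite indicE; case: (_ \in _); rewrite ?mul1r ?mul0r//.
rewrite nneseriesZl//; last by move=> i _; rewrite lee_fin mulr_ge0 ?powR_ge0// ltW.
by rewrite lte_mul_pinfty// lee_fin.
Qed.

Lemma path_ball_small (x y : nat) (r : R) : r <= 2 -> mball path_dist x r y ->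
  [\/ y = x, y = x.+1 | x = y.+1].
Proof.
move=> r2; rewrite /mball /path_dist /=.
case: eqVneq => [->|_]; first by constructor.
case: ifP => [/orP[/eqP|/eqP]|_]; [by constructor 3|by constructor 2|lra].
Qed.

Lemma path_ball_big (x : nat) (r : R) : 2 < r -> mball path_dist x r = setT.
Proof.
move=> r2; apply/seteqP; split => // y _; rewrite /mball /path_dist /=.
by case: ifP => _; [lra|case: ifP => _; lra].
Qed.

Hypothesis moment1 : path_moment_finite 1.

Lemma path_measure_lty (D : set X) : (mu D < +oo)%E.
Proof.
rewrite -[ltLHS]mul1e -(integral_cst mu (path_measurable D)).
apply: (@path_integral_lty D (cst 1) 1 1) => // i.
by rewrite mul1r powRr1// ler1n.
Qed.

Lemma path_admissible (x : nat) (r : R) : 0 < r ->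
  admissible_ball mu (mball path_dist x r).
Proof.
move=> r0; exists x, r; split => //; split => //.
rewrite path_measure_lty andbT (@lt_le_trans _ _ (w x)%:E) ?lte_fin//.
rewrite -path_measure1; apply: le_measure; rewrite ?inE; try exact: path_measurable.
by move=> _ ->; rewrite /mball /path_dist /= eqxx.
Qed.

Definition path_lip (A : R) (f : nat -> R) := forall i, `|f i.+1 - f i| <= A.

Lemma path_lip_le A f i : path_lip A f -> `|f i - f 0%N| <= A * i%:R.
Proof.
move=> fA; elim: i => [|i IH]; first by rewrite subrr normr0 mulr0.
rewrite (le_trans (ler_distD (f i) _ _))// -natr1 mulrDr mulr1 addrC.
by rewrite lerD.
Qed.

(** On a ball of radius at most 2 the values stay within A of the value at its centre. The only
    other ball is the whole space, where f grows at most linearly, so the p-th moment bounds the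
    integral; the mass there is at least [w 0]. *)
Lemma path_lip_bounded_osc A f p : 1 <= p -> path_lip A f ->
  path_moment_finite p -> bounded_osc mu p f.
Proof.
move=> p1 fA pfin.
have A0 : 0 <= A by apply: le_trans (fA 0%N).
have p0 : 0 <= p by lra.
pose g (x : X) := `|f x - f 0%N| `^ p.
have g0 x : 0 <= g x by exact: powR_ge0.
have Ioo : (\int[mu]_(x in setT) (g x)%:E < +oo)%E.
  apply: (@path_integral_lty setT g (A `^ p) p) => //; first exact: powR_ge0.
  move=> i; rewrite -powRM//; apply: le_powR => //.
  rewrite (le_trans (path_lip_le i fA))// ler_wpM2l// ler_nat//.
pose L := fine (\int[mu]_(x in setT) (g x)%:E)%E.
have L0 : 0 <= L by rewrite fine_ge0// integral_ge0// => x _; rewrite lee_fin.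
exists (A `^ p + L / w 0%N).
  by rewrite addr_ge0 ?powR_ge0// divr_ge0// ltW.
move=> B [x [r [r0 [-> _]]]]; have [r2|r2] := leP r 2.
  exists (f x); apply: (@mean_leW _ _ _ _ _ _ (A `^ p)).
    by rewrite lerDl divr_ge0// ltW.
  have := mean_le_cst mu (A `^ p) (path_measurable (mball path_dist x r)).
  apply: le_trans; apply: ge0_le_integral.
  - exact: path_measurable.
  - by move=> y _; rewrite lee_fin powR_ge0.
  - exact: path_measurable_fun.
  - exact: path_measurable_fun.
  - move=> y /(path_ball_small r2) H; rewrite lee_fin; apply: le_powR => //.
    by case: H => ->; rewrite ?subrr ?normr0//; rewrite distrC.
exists (f 0%N); apply: (@mean_leW _ _ _ _ _ _ (L / w 0%N)).
  by rewrite lerDr powR_ge0.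
rewrite path_ball_big// /mean_le -[leLHS]fineK; last first.
  by rewrite ge0_fin_numE// integral_ge0// => y _; rewrite lee_fin.
rewrite -/L -[X in (X%:E <= _)%E](divfK (lt0r_neq0 (w0 0%N))) EFinM.
apply: lee_wpmul2l; first by rewrite lee_fin divr_ge0// ltW.
rewrite -(@path_measure1 0%N); apply: le_measure; rewrite ?inE//; exact: path_measurable.
Qed.

Lemma path_lip_loc_integrable A f : path_lip A f -> loc_integrable mu f.
Proof.
move=> fA x r r0 _; apply/integrableP; split; first exact: path_measurable_fun.
have A0 : 0 <= A by apply: le_trans (fA 0%N).
apply: (@path_integral_lty _ (fun x => `|f x|) (A + `|f 0%N|) 1) => //.
  by rewrite addr_ge0.
move=> i; rewrite powRr1//.
have := path_lip_le i fA; have := ler_normD (f i - f 0%N) (f 0%N); rewrite subrK.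
have := normr_ge0 (f 0%N); have : 0 <= i%:R :> R by [].
by rewrite -natr1; nra.
Qed.

(** The ball of radius 2 about i contains i and i + 1, and its mass is at most a constant times the
    weight of either point. A bounded mean thus bounds the oscillation at both. *)
Lemma path_osc_lip f : bounded_osc mu 1 f -> exists A, path_lip A f.
Proof.
case=> C C0 H.
have K0 : 0 < K by have := wK 0; have := w0 0%N; have := w0 1%N; nra.
have K1 : 1 <= K by have := wK 0; have := wS 0; have := w0 0%N; have := w0 1%N; nra.
exists (2 * (C * (3 * K ^+ 2))) => i.
pose B := mball path_dist i 2.
have Bi : B i by rewrite /B /mball /path_dist /= eqxx.
have Bi1 : B i.+1.
  by rewrite /B /mball /path_dist /= eqxx orbT; case: ifP => _; lra.
have [c Hc] := H B (path_admissible i (ltr0n _ 2)).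
have wi1 := wK i.
(* At most three points, the heaviest two steps before i + 1, hence K^2. For i = 0 the predecessor
   is 0 itself, and K >= 1 is used. *)
have muB : (mu B <= (3 * K ^+ 2 * w i.+1)%:E)%E.
  have sub : B `<=` ([set i] `|` [set i.+1]) `|` [set i.-1].
    move=> y /(path_ball_small (lexx _))[->|->|e]; [by left; left|by left; right|].
    by right; rewrite /= e.
  have wp : w i.-1 <= K * w i.
    by case: (i) => [|j] //=; have := w0 0%N; nra.
  apply: (@le_trans _ _ (mu ([set i] `|` [set i.+1] `|` [set i.-1]))).
    by apply: le_measure; rewrite ?inE//; exact: path_measurable.
  apply: (le_trans (measureU2 _ (path_measurable _) (path_measurable _))).
  apply: (@le_trans _ _ ((mu [set i] + mu [set i.+1]) + mu [set i.-1])%E).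
    by apply: leeD => //; exact: (measureU2 _ (path_measurable _) (path_measurable _)).
  rewrite !path_measure1 -!EFinD lee_fin; have := w0 i.+1; have := w0 i.
  have h : K * w i <= K ^+ 2 * w i.+1 by rewrite expr2 -mulrA ler_pM2l.
  nra.
have bd j : B j -> w i.+1 <= w j -> `|f j - c| <= C * (3 * K ^+ 2).
  move=> Bj wj.
  have : ((w j * `|f j - c| `^ 1)%:E <= (C * (3 * K ^+ 2 * w i.+1))%:E)%E.
    apply: le_trans (@path_integral_ge B (fun x => `|f x - c| `^ 1) j _ Bj) _.
      by move=> x; exact: powR_ge0.
    by apply: (le_trans Hc); rewrite EFinM lee_wpmul2l// lee_fin.
  rewrite lee_fin powRr1// => h; have w1 := w0 i.+1.
  rewrite -(ler_pM2l w1); apply: (@le_trans _ _ (w j * `|f j - c|)).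
    by rewrite ler_wpM2r.
  by apply: (le_trans h); rewrite le_eqVlt; apply/orP; left; apply/eqP; ring.
have b0 := bd _ Bi (wS i); have b1 := bd _ Bi1 (lexx _).
have := ler_distD c (f i.+1) (f i); rewrite (distrC c); lra.
Qed.

(** Coincidence puts BMO^1 inside the larger-exponent space by [BMO_eq1]; the function i is in
    BMO^1, and its oscillation on the whole space yields the moment. Conversely, BMO^1 functions
    have bounded increments, which a finite moment suffices to control. *)
Lemma path_coincide p1 p2 : 1 <= p1 -> 1 <= p2 -> p1 != p2 ->
  bmo_coincide mu p1 p2 <-> path_moment_finite (Num.max p1 p2).
Proof.
wlog p12 : p1 p2 / p1 < p2 => [W|p11 p21 _].
  move=> h1 h2; rewrite neq_lt => /orP[|] h.
    by apply: W => //; rewrite lt_eqF.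
  have [|w1 w2] := W p2 p1 h h2 h1; first by rewrite lt_eqF.
  by rewrite maxC; split=> [/esym|/w2/esym].
rewrite (max_idPr (ltW p12)); have met := path_dist_metric.
split=> [e|pfin].
  pose f (i : nat) : R := i%:R.
  have fl : path_lip 1 f by move=> i; rewrite /f -natr1 addrAC subrr add0r normr1.
  have f1 : BMO mu 1 f.
    apply/BMOP => //; split; first exact: path_lip_loc_integrable fl.
    exact: path_lip_bounded_osc fl _.
  have : BMO mu p2 f by apply: (BMO_eq1 met p11 p12 _ f1); rewrite e.
  move=> /(BMOP met mu f p21)[_ [C C0 H]].
  have [c] := H _ (path_admissible 0%N (ltr0n _ 3)).
  rewrite path_ball_big ?ltr_nat// => Hc.
  have : mean_le mu (setT : set X) (fun x : X => (x : nat).+1%:R `^ p2)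
     (2 `^ p2 * C + 2 `^ p2 * (`|c| + 1) `^ p2).
    apply: mean_le_affine Hc => //; try exact: path_measurable_fun.
    move=> x _; apply: le_trans (powR_add_le _ _ _) => //; last by lra.
    apply: le_powR => //; first by lra.
    rewrite -natr1 addrA lerD2r; have := ler_norm (f x - c); have := ler_norm c.
    by rewrite /f; lra.
  rewrite /mean_le path_integral// => h.
  rewrite /path_moment_finite.
  under eq_eseriesr do rewrite -(mul1r (_ `^ _)).
  apply: le_lt_trans (le_trans _ h) _.
    apply: lee_nneseries => i _ => [_|]; last by rewrite indicT.
    by rewrite mul1r lee_fin mulr_ge0 ?powR_ge0// ltW.
  rewrite lte_mul_pinfty ?path_measure_lty// lee_fin.
  by rewrite addr_ge0 ?mulr_ge0 ?powR_ge0.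
have sub1 : BMO mu 1 `<=` BMO mu p2.
  move=> f /(BMOP met mu f (lexx _))[fi /path_osc_lip[A fA]].
  by apply/BMOP => //; split => //; exact: path_lip_bounded_osc fA pfin.
apply/seteqP; split; last by apply: BMO_decreasing => //; exact: ltW.
by apply: subset_trans sub1; exact: BMO_decreasing.
Qed.

End path_space.

(** * Dyadic weights *)

Section powR_base.
Variable R : realType.
Implicit Types a q : R.

Lemma powR_le1 a q : 1 <= a -> q <= 0 -> a `^ q <= 1.
Proof. by move=> a1 q0; have := ler_powR a1 q0; rewrite powRr0. Qed.

Lemma powR_ge1 a q : 1 <= a -> 0 <= q -> 1 <= a `^ q.
Proof. by move=> a1 q0; have := ler_powR a1 q0; rewrite powRr0. Qed.

Lemma powR_gt1 a q : 1 < a -> 0 < q -> 1 < a `^ q.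
Proof.
move=> a1 q0; rewrite /powR gt_eqF ?(lt_trans _ a1)// expR_gt1.
by rewrite mulr_gt0 ?ln_gt0.
Qed.

Lemma powR_lt1 a q : 1 < a -> q < 0 -> a `^ q < 1.
Proof.
move=> a1 q0; rewrite -(opprK q) powRN invf_lt1 ?powR_gt1 ?oppr_gt0//.
by rewrite powR_gt0// (lt_trans _ a1).
Qed.

End powR_base.

Section dyadic_weights.
Variables (R : realType) (c : nat -> R) (p0 : R).
Hypothesis c0 : forall j, 0 < c j.
Hypothesis cS : forall j, c j.+1 <= c j.
Hypothesis cK : forall j, c j <= 3 * c j.+1.
Hypothesis p0_ge1 : 1 <= p0.

(** Block j has 2^j points, on which (i + 1)^p is about 2^(jp). The exponent p0 + 1 makes its share
    of the p-th moment about c_j 2^(j(p - p0)). *)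
Definition dyadic_level (j : nat) : R := c j * (2 ^+ j) `^ (- (p0 + 1)).
Definition dyadic_weight (i : nat) : R := dyadic_level (trunc_log 2 i.+1).
Local Notation v := dyadic_level.
Local Notation w := dyadic_weight.

Let pow2_gt0 j : 0 < 2 ^+ j :> R.
Proof. by rewrite exprn_gt0. Qed.

Lemma dyadic_level_gt0 j : 0 < v j.
Proof. by rewrite mulr_gt0// powR_gt0. Qed.

Let level_pow j : (2 ^+ j.+1 : R) `^ (- (p0 + 1)) =
  2 `^ (- (p0 + 1)) * (2 ^+ j) `^ (- (p0 + 1)).
Proof. by rewrite exprS powRM// exprn_ge0. Qed.

Lemma dyadic_levelS j : v j.+1 <= v j.
Proof.
rewrite /v level_pow; apply: ler_pM => //.
- exact: ltW.
- rewrite -[leRHS]mul1r ler_wpM2r ?powR_ge0//.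
  by apply: powR_le1; [by rewrite ler1n|rewrite oppr_le0 addr_ge0 ?(le_trans ler01)].
Qed.

Lemma dyadic_levelK j : v j <= (3 * 2 `^ (p0 + 1)) * v j.+1.
Proof.
rewrite /v level_pow (powRN 2).
have a0 : 0 < 2 `^ (p0 + 1) :> R by rewrite powR_gt0.
have b0 : 0 < (2 ^+ j : R) `^ (- (p0 + 1)) by rewrite powR_gt0.
set A := 2 `^ (p0 + 1) in a0 *; set b := _ `^ _ in b0 *.
have -> : 3 * A * (c j.+1 * (A^-1 * b)) = (3 * c j.+1) * b.
  by field; rewrite gt_eqF.
by rewrite ler_pM2r.
Qed.

Lemma dyadic_weight_gt0 i : 0 < w i.
Proof. exact: dyadic_level_gt0. Qed.

Let trunc_log_step i : trunc_log 2 i.+2 = trunc_log 2 i.+1 \/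
  trunc_log 2 i.+2 = (trunc_log 2 i.+1).+1.
Proof.
have h1 : (trunc_log 2 i.+1 <= trunc_log 2 i.+2)%N by exact: leq_trunc_log.
have h2 : (trunc_log 2 i.+2 <= (trunc_log 2 i.+1).+1)%N.
  by rewrite -trunc_logMp//; apply: leq_trunc_log; lia.
by lia.
Qed.

Lemma dyadic_weightS i : w i.+1 <= w i.
Proof. by rewrite /w; case: (trunc_log_step i) => ->//; exact: dyadic_levelS. Qed.

Lemma dyadic_weightK i : w i <= (3 * 2 `^ (p0 + 1)) * w i.+1.
Proof.
rewrite /w; case: (trunc_log_step i) => ->; last exact: dyadic_levelK.
apply: (le_trans (dyadic_levelK _)); rewrite ler_wpM2l ?dyadic_levelS//.
Qed.

Let block_term (p : R) j : (2 ^+ j) * (v j * (2 ^+ j) `^ p) = c j * (2 `^ (p - p0)) ^+ j.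
Proof.
have P0 := pow2_gt0 j.
have -> : (2 `^ (p - p0)) ^+ j = (2 ^+ j : R) `^ (p - p0).
  by rewrite -powR_mulrn ?powR_ge0// -powRrM mulrC powRrM powR_mulrn.
have -> : p - p0 = 1 + (- (p0 + 1) + p) by ring.
rewrite powRD; last by rewrite (gt_eqF P0) implybT.
rewrite powRD; last by rewrite (gt_eqF P0) implybT.
rewrite powRr1 ?ltW// /v; ring.
Qed.

Let block_trunc j i : (2 ^ j - 1 <= i < 2 ^ j.+1 - 1)%N -> trunc_log 2 i.+1 = j.
Proof.
move=> /andP[h1 h2]; apply: trunc_log_eq => //.
by have := expn_gt0 2 j; lia.
Qed.

Let block_size j : (2 ^ j.+1 - 1 - (2 ^ j - 1) = 2 ^ j)%N.
Proof. by rewrite expnS; have := expn_gt0 2 j; lia. Qed.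

Lemma dyadic_block_ge (p : R) j : 0 <= p -> c j * (2 `^ (p - p0)) ^+ j <=
  \sum_(2 ^ j - 1 <= i < 2 ^ j.+1 - 1) w i * i.+1%:R `^ p.
Proof.
move=> pp; rewrite -block_term.
have -> : 2 ^+ j * (v j * (2 ^+ j) `^ p) =
    \sum_(2 ^ j - 1 <= i < 2 ^ j.+1 - 1) (v j * (2 ^+ j) `^ p).
  by rewrite sumr_const_nat block_size -[RHS]mulr_natl natrX.
apply: ler_sum_nat => i hi; rewrite /w (block_trunc hi).
apply: ler_wpM2l; first exact/ltW/dyadic_level_gt0.
apply: le_powR => //.
by rewrite -natrX ler_nat; lia.
Qed.

Lemma dyadic_block_le (p : R) j : 0 <= p ->
  \sum_(2 ^ j - 1 <= i < 2 ^ j.+1 - 1) w i * i.+1%:R `^ p <=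
  2 `^ p * (c j * (2 `^ (p - p0)) ^+ j).
Proof.
move=> pp; rewrite -block_term.
have -> : 2 `^ p * (2 ^+ j * (v j * (2 ^+ j) `^ p)) =
    \sum_(2 ^ j - 1 <= i < 2 ^ j.+1 - 1) (v j * (2 ^+ j.+1) `^ p).
  rewrite sumr_const_nat block_size -[RHS]mulr_natl natrX exprS.
  by rewrite powRM ?exprn_ge0//; ring.
apply: ler_sum_nat => i hi; rewrite /w (block_trunc hi).
apply: ler_wpM2l; first exact/ltW/dyadic_level_gt0.
apply: le_powR => //.
by rewrite -natrX ler_nat; lia.
Qed.

(** Summing over whole blocks, the moment and the model series agree up to the factor 2^p, the
    variation of (i + 1)^p across a block. *)
Lemma dyadic_momentP (p : R) : 0 <= p ->
  path_moment_finite w p <->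
  exists L, forall J, \sum_(0 <= j < J) c j * (2 `^ (p - p0)) ^+ j <= L.
Proof.
move=> pp; rewrite /path_moment_finite nneseries_lty; last first.
  by move=> i; rewrite mulr_ge0 ?powR_ge0// ltW// dyadic_weight_gt0.
have blocks J : \sum_(0 <= i < 2 ^ J - 1) w i * i.+1%:R `^ p =
    \sum_(0 <= j < J) \sum_(2 ^ j - 1 <= i < 2 ^ j.+1 - 1) w i * i.+1%:R `^ p.
  elim: J => [|J IH]; first by rewrite !big_geq.
  rewrite big_nat_recr//= -IH -big_cat_nat//=.
  by rewrite leq_sub2r// leq_exp2l.
split=> -[L HL].
  exists L => J; apply: le_trans (HL (2 ^ J - 1)%N); rewrite blocks.
  by apply: ler_sum_nat => j _; exact: dyadic_block_ge.
exists (2 `^ p * L) => n.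
(* The first n points lie in the first n blocks. *)
have nJ : (n <= 2 ^ n - 1)%N by have : (n < 2 ^ n)%N by [exact: ltn_expl]; lia.
apply: (@le_trans _ _ (\sum_(0 <= i < 2 ^ n - 1) w i * i.+1%:R `^ p)).
  rewrite (@big_cat_nat _ _ _ n 0 (2 ^ n - 1)%N)//= lerDl sumr_ge0// => i _.
  by rewrite mulr_ge0 ?powR_ge0// ltW// dyadic_weight_gt0.
rewrite blocks; apply: (@le_trans _ _
  (\sum_(0 <= j < n) 2 `^ p * (c j * (2 `^ (p - p0)) ^+ j))).
  by apply: ler_sum_nat => j _; exact: dyadic_block_le.
by rewrite -mulr_sumr ler_wpM2l ?powR_ge0.
Qed.

Lemma dyadic_space : path_moment_finite w 1 ->
  exists (T : pointedType) (rho : T -> T -> R)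
         (mu : {measure set (borelT rho) -> \bar R}), is_metric rho /\
  forall p1 p2 : R, 1 <= p1 -> 1 <= p2 -> p1 != p2 ->
    bmo_coincide mu p1 p2 <->
    exists L, forall J,
      \sum_(0 <= j < J) c j * (2 `^ (Num.max p1 p2 - p0)) ^+ j <= L.
Proof.
move=> m1; exists nat, (@path_dist R), (path_measure dyadic_weight_gt0).
split=> [|p1 p2 h1 h2 n12]; first exact: path_dist_metric.
rewrite -dyadic_momentP; last by rewrite le_max; apply/orP; left; lra.
exact: (path_coincide dyadic_weight_gt0 dyadic_weightS dyadic_weightK m1).
Qed.

End dyadic_weights.

(** * Convergence of the two model series *)

Section exponent_sums.
Variable R : realType.
Implicit Types p : R.

(** For p >= p0 every term is at least 1 and the partial sums grow linearly; otherwise the ratio is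
    below 1. The factor 1 stands for the constant choice of [c]. *)
Lemma geometric_bounded p p0 :
  (exists L : R, forall J, \sum_(0 <= j < J) 1 * (2 `^ (p - p0)) ^+ j <= L) <-> p < p0.
Proof.
split=> [[L HL]|pp].
  rewrite ltNge; apply/negP => pp.
  have x1 : 1 <= 2 `^ (p - p0) :> R by apply: powR_ge1; [rewrite ler1n|lra].
  have := HL (Num.bound `|L|); apply/negP; rewrite -ltNge.
  apply: (@lt_le_trans _ _ (Num.bound `|L|)%:R).
    by rewrite (le_lt_trans (ler_norm _))// archi_boundP.
  rewrite -[leLHS]mul1r mulr_natr -[X in _ *+ X]subn0 -sumr_const_nat.
  by apply: ler_sum_nat => j _; rewrite mul1r exprn_ege1.
have /andP[x0 x1] : (0 : R) < 2 `^ (p - p0) < 1 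
  by rewrite powR_gt0//= powR_lt1 ?ltr1n ?subr_lt0.
set x := 2 `^ _ in x0 x1 *.
exists (1 - x)^-1 => J.
rewrite -[leRHS]mul1r ler_pdivlMr ?subr_gt0//.
under eq_bigr do rewrite mul1r.
have := subrX1 x J; rewrite -(big_mkord xpredT (fun i => x ^+ i)) => e.
have : 0 <= x ^+ J by rewrite exprn_ge0// ltW.
lra.
Qed.

Lemma quadratic_geometric_bounded p p0 :
  (exists L : R, forall J, \sum_(0 <= j < J)
     (j.+1%:R * j.+2%:R)^-1 * (2 `^ (p - p0)) ^+ j <= L) <-> p <= p0.
Proof.
have d0 j : 0 < j.+1%:R * j.+2%:R :> R by rewrite mulr_gt0.
split=> [[L HL]|pp]; last first.
  exists 1 => J.
  apply: (@le_trans _ _ (\sum_(0 <= j < J) (j.+1%:R * j.+2%:R)^-1)).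
    apply: ler_sum_nat => j _; rewrite -[leRHS]mulr1 ler_wpM2l ?invr_ge0 ?(ltW (d0 j))//.
    by apply: exprn_ile1; rewrite ?powR_ge0//; apply: powR_le1; [by rewrite ler1n|lra].
  (* Telescoping sum. *)
  have -> : \sum_(0 <= j < J) (j.+1%:R * j.+2%:R)^-1 = 1 - J.+1%:R^-1 :> R.
    elim: J => [|J IH]; first by rewrite big_geq// invr1 subrr.
    rewrite big_nat_recr//= IH -(natr1 J.+1) -(natr1 J).
    have : 0 <= J%:R :> R by [].
    by move=> J0; field; apply/andP; split; lra.
  by rewrite lerBlDr lerDl invr_ge0.
rewrite leNgt; apply/negP => pp.
(* Bernoulli for the cube root of the ratio gives cubic growth, which beats the
   quadratic denominators. *)
pose y : R := 2 `^ ((p - p0) / 3).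
have y1 : 1 < y.
  by apply: powR_gt1; rewrite ?ltr1n// divr_gt0 ?subr_gt0.
have y3 : 2 `^ (p - p0) = y ^+ 3.
  by rewrite -powR_mulrn ?powR_ge0// -powRrM divfK.
pose h := y - 1; have h0 : 0 < h by rewrite subr_gt0.
have yj j : j%:R * h <= y ^+ j.
  elim: j => [|j IH]; first by rewrite mul0r expr0.
  have : 1 <= y ^+ j by rewrite exprn_ege1// ltW.
  by rewrite exprS -natr1 /h in h0 IH *; nra.
(* For j >= 1 the denominator (j + 1)(j + 2) is at most 6 j^2, against a numerator of at least
   (jh)^3. The n-th term alone then exceeds L. *)
have term j : j%:R * h ^+ 3 / 6 <= (j.+1%:R * j.+2%:R)^-1 * (2 `^ (p - p0)) ^+ j.
  rewrite y3 exprAC [leRHS]mulrC ler_pdivlMr//.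
  have [->|j0] := posnP j; first by rewrite !mul0r exprn_ge0// exprn_ge0// ltW; lra.
  have jr : 1 <= j%:R :> R by rewrite ler1n.
  apply: (@le_trans _ _ ((j%:R * h) ^+ 3)); last first.
    by apply: lerXn2r; rewrite ?nnegrE ?yj// ?mulr_ge0 ?exprn_ge0//; lra.
  have h30 : 0 <= h ^+ 3 by rewrite exprn_ge0// ltW.
  rewrite exprMn -(natr1 j.+1) -(natr1 j).
  have -> : j%:R * h ^+ 3 / 6 * ((j%:R + 1) * (j%:R + 1 + 1)) =
     (j%:R * ((j%:R + 1) * (j%:R + 1 + 1)) / 6) * h ^+ 3 by field.
  by apply: ler_wpM2r => //; rewrite ler_pdivrMr//; nra.
have c0 : 0 < h ^+ 3 / 6 by rewrite divr_gt0// exprn_gt0.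
pose n := Num.bound (`|L| / (h ^+ 3 / 6)).
have Ln : `|L| < n%:R * (h ^+ 3 / 6).
  rewrite -ltr_pdivrMr//; apply: archi_boundP.
  by rewrite divr_ge0// ltW.
have := HL n.+1; apply/negP; rewrite -ltNge.
apply: (le_lt_trans (ler_norm _)); apply: (lt_le_trans Ln).
rewrite mulrA big_nat_recr//=; apply: (le_trans (term n)).
rewrite lerDr sumr_ge0// => j _.
Qed.

End exponent_sums.

(** * Realization of the three cases *)

Lemma realize_caseB (R : realType) (p0 : R) : 1 < p0 ->
  exists (T : pointedType) (rho : T -> T -> R)
         (mu : {measure set (borelT rho) -> \bar R}),
    is_metric rho /\ caseB mu p0.
Proof.
move=> p01.
have [|||||T [rho [mu [met H]]]] := @dyadic_space R (fun=> 1) p0.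
- by [].
- by [].
- by move=> _; rewrite mulr1 ler1n.
- exact: ltW.
- by apply/dyadic_momentP => //; [exact: ltW|exact/geometric_bounded].
exists T, rho, mu; split => //; split => // p1 p2 h1 h2 n12.
by rewrite H// geometric_bounded.
Qed.

Lemma realize_caseC (R : realType) (p0 : R) : 1 <= p0 ->
  exists (T : pointedType) (rho : T -> T -> R)
         (mu : {measure set (borelT rho) -> \bar R}),
    is_metric rho /\ caseC mu p0.
Proof.
move=> p01; pose c j : R := (j.+1%:R * j.+2%:R)^-1.
have c0 j : 0 < c j by rewrite invr_gt0 mulr_gt0.
have cS j : c j.+1 <= c j.
  by rewrite lef_pV2 ?posrE ?mulr_gt0// ler_pM// ler_nat.
(* The ratio of consecutive terms is (j + 3) / (j + 1), largest at j = 0. *)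
have cK j : c j <= 3 * c j.+1.
  rewrite /c -(natr1 j.+2) -(natr1 j.+1) -(natr1 j).
  have : 0 <= j%:R :> R by [].
  set x := j%:R => x0.
  have -> : 3 * ((x + 1 + 1) * (x + 1 + 1 + 1))^-1 =
    ((x + 1) * 3 / (x + 1 + 1 + 1)) * ((x + 1) * (x + 1 + 1))^-1.
    by field; do ?[apply/andP; split]; lra.
  rewrite -[leLHS]mul1r ler_wpM2r ?invr_ge0; first by [].
    by rewrite mulr_ge0; lra.
  by rewrite ler_pdivlMr; lra.
have [|T [rho [mu [met H]]]] := @dyadic_space R c p0 c0 cS cK p01.
  by apply/dyadic_momentP => //; exact/quadratic_geometric_bounded.
exists T, rho, mu; split => //; split => // p1 p2 h1 h2 n12.
by rewrite H// quadratic_geometric_bounded.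
Qed.

(** For the zero measure no ball is admissible, so every norm is -oo and each BMO^p consists of all
    locally integrable functions. *)
Lemma realize_caseA (R : realType) :
  exists (T : pointedType) (rho : T -> T -> R)
         (mu : {measure set (borelT rho) -> \bar R}),
    is_metric rho /\ caseA mu.
Proof.
exists nat, (@path_dist R), mzero; split; first exact: path_dist_metric.
have no_ball B : ~ admissible_ball
    (mzero : {measure set (borelT (@path_dist R)) -> \bar R}) B.
  by case=> x [r [r0 [e]]]; rewrite /mzero ltxx.
have norm p f : bmo_norm
    (mzero : {measure set (borelT (@path_dist R)) -> \bar R}) p f = -oo%E.
  by apply/eqP; rewrite -leeNy_eq; apply: ge_ereal_sup => y [B aB _]; case: (no_ball B aB).
by move=> p1 p2 _ _; apply/seteqP; split => f [fi h]; split => //; rewrite norm.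
Qed.

Theorem theorem5p1p1 (R : realType) :
  (forall (T : pointedType) (rho : T -> T -> R)
          (mu : {measure set (borelT rho) -> \bar R}),
     is_metric rho ->
     exactly_one3 (caseA mu) (exists p0 : R, caseB mu p0)
                  (exists p0 : R, caseC mu p0)) /\
  (exists (T : pointedType) (rho : T -> T -> R)
          (mu : {measure set (borelT rho) -> \bar R}),
     is_metric rho /\ caseA mu) /\
  (forall p0 : R, 1 < p0 ->
     exists (T : pointedType) (rho : T -> T -> R)
            (mu : {measure set (borelT rho) -> \bar R}),
       is_metric rho /\ caseB mu p0) /\
  (forall p0 : R, 1 <= p0 ->
     exists (T : pointedType) (rho : T -> T -> R)
            (mu : {measure set (borelT rho) -> \bar R}),
       is_metric rho /\ caseC mu p0).
Proof.
split; first by move=> T rho mu met; exact: trichotomy.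
split; first exact: realize_caseA.
by split=> p0; [exact: realize_caseB|exact: realize_caseC].
Qed.
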